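(* Let $T$ be a tree on $n$ vertices. If $T$ has a perfect matching, then $\gamma_{WC}(T)=s_{WC}(T)=n/2$. In all other cases, Dominator does not win the $(1:1)$ Waiter-Client domination game on $T$.
   Context: The (unbiased) Waiter-Client domination game on a graph $G$: in each round Dominator (Waiter) offers two unclaimed vertices of $G$, Staller (Client) picks one of them for himself and the other goes to Dominator; if in the last round only one unclaimed vertex remains, it goes to Staller. Dominator wins if she claims all vertices of some dominating set of $G$. $\gamma_{WC}(G)$ is the smallest number of rounds within which Dominator can always occupy a dominating set, and $s_{WC}(G)$ is the smallest size of a dominating set Dominator can always claim (both $\infty$ if Dominator has no winning strategy). *)

(* Defs.v *)
From mathcomp Require Import all_boot.
From mathcomp Require Import boolp.

Set Implicit Arguments.
Unset Strict Implicit.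
Unset Printing Implicit Defensive.

(* [None] stands for infinity. *)
Definition least (P : nat -> Prop) : option nat :=
  if pselect (exists k, `[< P k >]) is left exP then Some (ex_minn exP)
  else None.

(* A graph is given by its adjacency relation [e] on the vertex type [V]. *)
Section Graph.
Variables (V : finType) (e : rel V).

Definition simple_graph : Prop := symmetric e /\ irreflexive e.

Definition connected_graph : Prop := 0 < #|V| /\ forall x y : V, connect e x y.

(* For a simple graph, the sequences [[::]] and [[:: x; y]] with [e x y] also
   satisfy [ucycle e]; the cycles of the graph are those of size at least 3. *)
Definition acyclic_graph : Prop := forall c : seq V, ucycle e c -> size c < 3.

Definition tree : Prop := [/\ simple_graph, connected_graph & acyclic_graph].

Definition edges : {set {set V}} :=
  [set [set p.1; p.2] | p : V * V & e p.1 p.2].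

Definition perfect_matching (M : {set {set V}}) : bool :=
  (M \subset edges) && partition M [set: V].

Definition has_perfect_matching : Prop :=
  exists M : {set {set V}}, perfect_matching M.

Definition dominating (A : {set V}) : bool :=
  [forall v, (v \in A) || [exists u in A, e u v]].

End Graph.

Section WaiterClient.
Variable V : finType.

(* The vertices claimed by Dominator (Waiter) and by Staller (Client). *)
Record position := Position { dom : {set V}; stal : {set V} }.

Definition unclaimed (p : position) : {set V} := ~: (dom p :|: stal p).

(* One round in which Dominator offers [o]; Staller keeps [o.1] if [c] and
   [o.2] otherwise. If fewer than two vertices are unclaimed, the offer is
   ignored and Staller receives the remaining vertex, if any, so that nothing
   changes once the board is exhausted. *)
Definition play_round (o : V * V) (c : bool) (p : position) : position :=
  if 1 < #|unclaimed p| then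
    if c then Position (o.2 |: dom p) (o.1 |: stal p)
    else Position (o.1 |: dom p) (o.2 |: stal p)
  else Position (dom p) (unclaimed p :|: stal p).

(* Dominator's next offer as a function of Staller's choices so far, the most
   recent one first; her own earlier offers are determined by these. *)
Definition strategy := seq bool -> V * V.

Fixpoint play (sigma : strategy) (cs : seq bool) : position :=
  if cs is c :: cs' then play_round (sigma cs') c (play sigma cs')
  else Position set0 set0.

Definition legal (sigma : strategy) : Prop :=
  forall cs, 1 < #|unclaimed (play sigma cs)| ->
    [/\ (sigma cs).1 != (sigma cs).2,
        (sigma cs).1 \in unclaimed (play sigma cs)
      & (sigma cs).2 \in unclaimed (play sigma cs)].

Variable e : rel V.

Definition dominator_wins : Prop :=
  exists2 sigma : strategy, legal sigma &
    forall cs, unclaimed (play sigma cs) = set0 ->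
      exists2 A : {set V}, dominating e A & A \subset dom (play sigma cs).

Definition wins_within_rounds (k : nat) : Prop :=
  exists2 sigma : strategy, legal sigma &
    forall cs, size cs = k ->
      exists2 A : {set V}, dominating e A & A \subset dom (play sigma cs).

Definition wins_with_size (s : nat) : Prop :=
  exists2 sigma : strategy, legal sigma &
    forall cs, unclaimed (play sigma cs) = set0 ->
      exists2 A : {set V}, dominating e A &
        A \subset dom (play sigma cs) /\ #|A| <= s.

Definition gammaWC : option nat := least wins_within_rounds.

Definition sWC : option nat := least wins_with_size.

End WaiterClient.

(* Main.v *)
(** Upper bounds: Dominator offers the edges of a perfect matching one by one.

    Lower bounds: peel a forest by repeatedly removing a leaf [v_i] of what
    remains together with its neighbour [u_i], until everything is removed or an
    isolated vertex [w] appears, and list the vertices as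
    [u_1, v_1, u_2, v_2, ..., w].  Staller always keeps the offered vertex that
    comes first in this list, so no prefix of it contains more vertices of
    Dominator than of Staller.  If [(u_i, v_i)] is the first pair in which
    Staller does not own exactly [u_i], then he owns both its vertices and all
    [u_j] with [j < i], hence the closed neighbourhood of [v_i]; if there is no
    such pair but there is a [w], he owns the closed neighbourhood of [w].  In
    the remaining case the removed edges form a perfect matching and Dominator
    owns exactly the [v_i], which are independent, so none can be omitted from a
    dominating set. *)
Require Import Defs.
From mathcomp Require Import all_boot.
From mathcomp Require Import boolp.
From mathcomp Require Import zify.

Set Implicit Arguments.
Unset Strict Implicit.
Unset Printing Implicit Defensive.

Lemma least_eq (P : nat -> Prop) (m : nat) :
  P m -> (forall k, P k -> m <= k) -> least P = Some m.
Proof.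
move=> Pm Pmin; rewrite /least; case: pselect => [exP|]; last first.
  by case; exists m; apply/asboolP.
case: ex_minnP => k /asboolP Pk kmin; congr Some; apply/eqP.
by rewrite eqn_leq Pmin // kmin //; apply/asboolP.
Qed.

Lemma count_setU1_uniq (T : finType) (x : T) (A : {set T}) (s : seq T) :
  uniq s -> x \notin A -> count (mem (x |: A)) s = (x \in s) + count (mem A) s.
Proof.
move=> us xA; rewrite -(count_uniq_mem x us).
elim: s {us} => //= y s ->; rewrite !inE.
by have [->|] := eqVneq y x; rewrite ?(negPf xA) /=; lia.
Qed.

(** * Peeling orders and perfect matchings of acyclic graphs *)

Section Graph.
Variables (V : finType) (e : rel V).

(** If every vertex of [R] had two neighbours in [R], a path in [R] could be prolonged at its front
    forever, since a new front vertex already on the path would close a cycle. A path with [#|V|]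
    edges has too many vertices. *)
Lemma acyclic_low_degree (R : {set V}) :
  simple_graph e -> acyclic_graph e -> R != set0 ->
  exists2 v, v \in R & #|[set x in R | e v x]| <= 1.
Proof.
move=> [e_sym e_irr] acyc /set0Pn [x0 x0R]; apply: contrapT => no_leaf.
have deg v : v \in R -> 1 < #|[set x in R | e v x]|.
  by move=> vR; rewrite ltnNge; apply/negP => le1; apply: no_leaf; exists v.
suff long n : exists x p,
    [/\ path e x p, uniq (x :: p), {subset x :: p <= R} & size p = n].
  have [x [p [_ up _ sp]]] := long #|V|.
  by have := max_card (mem (x :: p)); rewrite (card_uniqP up) /= sp ltnn.
elim: n => [|n [x [p [xp up pR sp]]]].
  by exists x0, [::]; split=> // y; rewrite inE => /eqP->.
have xR : x \in R by apply: pR; rewrite mem_head.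
(* [head x p] is the successor of [x] on the path. For empty [p] it is [x] itself, which is no
   neighbour of [x]. *)
have [y yR /andP[exy y2]] : exists2 y, y \in R & e x y && (y != head x p).
  have /card_gt1P [y [z]] := deg x xR.
  rewrite !inE => -[/andP[yR exy] /andP[zR exz] yz].
  have [yh|yh] := eqVneq y (head x p); last by exists y; rewrite ?exy.
  by exists z; rewrite // exz -yh eq_sym.
have eyx : e y x by rewrite e_sym.
have [yp|yp] := boolP (y \in x :: p); last first.
  exists y, (x :: p); split=> //=; rewrite ?eyx ?yp ?sp //.
  by move=> z; rewrite inE => /predU1P[->|/pR].
move: yp; rewrite inE; case/predU1P=> [yx|]; first by rewrite yx e_irr in eyx.
case: p xp up {pR sp} y2 => [|z q] // /andP[exz zq] up yz.
rewrite inE (negPf (yz : y != z)) /= => yq.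
have {}zq : path e z q by [].
case/splitPr: yq zq up => q1 q2.
rewrite cat_path => /andP[zq1 /andP[lq1 _]].
rewrite -cat_rcons -2!cat_cons cat_uniq => /andP[uc _].
(* As [y] lies on the path beyond [z], the edge back to [x] closes a cycle on at least three
   vertices. *)
have : ucycle e (x :: z :: rcons q1 y).
  by rewrite /ucycle uc andbT /= exz !rcons_path last_rcons zq1 lq1.
by move/acyc; rewrite /= size_rcons.
Qed.

(** The condition of the ballot problem. It is all that the peeling argument needs to know about
    Dominator's final set. *)
Definition ballot (D : {set V}) (L : seq V) : Prop :=
  forall k, count (mem D) (take k L) <= count (mem (~: D)) (take k L).

(** The game is hidden behind an arbitrary [D], and [R] is arbitrary for the induction on its size.
    In the first alternative [D] misses the closed neighbourhood of [w] inside [R], so for [R] the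
    whole vertex set [D] does not dominate [w]. *)
Lemma peeling_order (R : {set V}) :
  simple_graph e -> acyclic_graph e ->
  exists2 L : seq V, uniq L & {subset L <= R} /\
    forall D : {set V}, ballot D L ->
      (exists2 w, w \in R & {in R, forall x, (x == w) || e w x -> x \notin D})
      \/ [/\ exists2 M : {set {set V}}, M \subset edges e & partition M R,
             {in D :&: R &, forall x y, ~~ e x y}
           & #|D :&: R|.*2 = #|R|].
Proof.
move=> sg acyc; have [e_sym e_irr] := sg.
have [n] := ubnP #|R|; elim: n R => // n IHn R ltRn.
have [->|R0] := eqVneq R set0.
  exists [::] => //; split=> // D _; right; rewrite setI0 cards0; split=> //.
    by exists set0; rewrite ?sub0set ?partition_set0.
  by move=> x y; rewrite inE.
have [v vR] := acyclic_low_degree sg acyc R0.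
rewrite leq_eqVlt ltnS leqn0 => /orP[/cards1P[u Nv]|/eqP/cards0_eq Nv]; last first.
  exists [:: v] => //; split=> [x|D bal]; first by rewrite inE => /eqP->.
  left; exists v => // x xR /predU1P[->|evx].
    by have := bal 1; rewrite /= !inE; case: (v \in D).
  by move/setP/(_ x): Nv; rewrite !inE xR evx.
have NvE x : x \in R -> e v x = (x == u).
  by move=> xR; move/setP/(_ x): Nv; rewrite !inE xR.
have [uR evu] : u \in R /\ e v u.
  by have := set11 u; rewrite -Nv inE => /andP.
have uv : u != v by apply: contraTneq evu => ->; rewrite e_irr.
pose R' := R :\: [set u; v].
have RE : R = [set u; v] :|: R'.
  by rewrite /R' setDE setUIr setUCr setIT; apply/esym/setUidPr; rewrite subUset !sub1set uR.
have dR : [disjoint [set u; v] & R'] by rewrite -setI_eq0 /R' setDE setICA setICr setI0.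
have cR : #|R| = #|R'|.+2.
  by rewrite RE cardsU (disjoint_setI0 dR) cards0 cards2 uv subn0.
have [|L' uL' [sL' PL']] := IHn R'; first by rewrite cR in ltRn; lia.
have uL'n x : x \in [set u; v] -> x \notin L'.
  by move=> xuv; apply/negP => /sL'; rewrite inE xuv.
exists [:: u, v & L'].
  by rewrite /= inE (negPf uv) !uL'n ?set21 ?set22.
split=> [x|D bal].
  by rewrite !inE => /or3P[/eqP->|/eqP->|/sL'] //; rewrite inE => /andP[].
have uD : u \notin D.
  by have := bal 1; rewrite /= !inE; case: (u \in D).
have [vD|vD] := boolP (v \in D); last first.
  by left; exists v => // x xR /predU1P[->//|]; rewrite NvE // => /eqP->.
have [k|[w wR' Hw]|[[M Me Mp] ind cD]] := PL' D.
(* The pair [u], [v] adds one to each side of the count, so the ballot condition passes from [L] to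
   its tail [L']. *)
- by have := bal k.+2; rewrite /= !inE (negPf uD) vD /=; lia.
- move: (wR'); rewrite !inE negb_or => /andP[/andP[wu wv] wR].
  (* Returning to [R] does no harm to [w]: [u] is outside [D], and [v] is not adjacent to [w]
     because its only neighbour in [R] is [u]. *)
  left; exists w => // x; rewrite RE inE => /orP[|xR']; last exact: Hw.
  rewrite !inE => /orP[/eqP->//|/eqP->].
  by rewrite eq_sym (negPf wv) e_sym NvE // (negPf wu).
have DR : D :&: R = v |: (D :&: R').
  apply/setP => x; rewrite !inE; have [->|_] := eqVneq x v; first by rewrite vD vR.
  by have [->|] := eqVneq x u; rewrite //= (negPf uD).
right; split.
- exists ([set u; v] |: M).
    rewrite subUset Me andbT sub1set; apply/imsetP; exists (u, v) => //.
    by rewrite inE /= e_sym.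
  have [/eqP cM tM M0] := and3P Mp.
  have uvM B : B \in M -> [disjoint [set u; v] & B].
    move=> BM; apply: disjointWr dR; rewrite -cM; exact: bigcup_sup.
  rewrite /partition /cover big_setU1 /=; last first.
    apply/negP => /uvM; rewrite -setI_eq0 setIid => /eqP/setP/(_ u).
    by rewrite !inE eqxx.
  rewrite -/(cover M) cM -RE eqxx /= !inE negb_or M0 andbT; apply/andP; split.
    apply/trivIsetP => A B; rewrite !inE => /predU1P[->|AM] /predU1P[->|BM].
    + by rewrite eqxx.
    + by move=> _; exact: uvM.
    + by move=> _; rewrite disjoint_sym; exact: uvM.
    + exact: (trivIsetP tM).
  by apply/eqP => /setP/(_ u); rewrite !inE eqxx.
- have vind x : x \in D :&: R -> ~~ e v x.
    by rewrite inE => /andP[xD xR]; rewrite NvE //; apply: contraNneq uD => <-.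
  move=> x y xDR yDR; move: (xDR) (yDR); rewrite {1 2}DR.
  move=> /setU1P[->|xR'] /setU1P[->|yR'].
  + by rewrite e_irr.
  + exact: vind.
  + by rewrite e_sym; exact: vind.
  + exact: ind.
- rewrite DR cardsU1 !inE eqxx orbT andbF cR -cD; lia.
Qed.

(** A vertex of [D] left out of [A] would have a neighbour in [A], hence in [D], against
    independence. *)
Lemma dominating_indep (A D : {set V}) :
  A \subset D -> dominating e A -> {in D &, forall x y, ~~ e x y} -> A = D.
Proof.
move=> AD domA ind; apply/eqP; rewrite eqEsubset AD; apply/subsetP => x xD.
have /orP[//|/existsP[y /andP[yA eyx]]] := forallP domA x.
by have := ind y x (subsetP AD _ yA) xD; rewrite eyx.
Qed.

Definition vertices_of (ps : seq (V * V)) : seq V :=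
  flatten [seq [:: p.1; p.2] | p <- ps].

(** Listing the matching edges as ordered pairs lets the round number select Dominator's offer. *)
Lemma perfect_matching_pairs :
  irreflexive e -> has_perfect_matching e ->
  exists ps : seq (V * V), [/\ all (fun p => e p.1 p.2) ps,
    uniq (vertices_of ps) & forall x, x \in vertices_of ps].
Proof.
move=> e_irr [M /andP[/subsetP Me /and3P[/eqP cM /trivIsetP tM _]]].
have gen (Bs : seq {set V}) : uniq Bs -> {subset Bs <= M} ->
    exists ps : seq (V * V), [/\ all (fun p => e p.1 p.2) ps,
    uniq (vertices_of ps)
    & forall x, (x \in vertices_of ps) = has (fun B : {set V} => x \in B) Bs].
  elim: Bs => [|B Bs IH]; first by exists [::].
  move=> /andP[BBs uBs] sBM.
  have BM : B \in M by apply: sBM; rewrite mem_head.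
  have sM : {subset Bs <= M} by move=> C CBs; apply: sBM; rewrite inE CBs orbT.
  have [ps [eps ups mps]] := IH uBs sM.
  have /imsetP[[a b]] := Me B BM; rewrite inE /= => eab defB.
  have disj x : x \in B -> x \notin vertices_of ps.
    move=> xB; rewrite mps; apply/hasPn => C CBs; apply/negP => xC.
    have BC : B != C by apply: contraNneq BBs => ->.
    by have /disjointFr/(_ xB) := tM B C BM (sM C CBs) BC; rewrite xC.
  exists ((a, b) :: ps); split; first by rewrite /= eab.
    rewrite /= inE negb_or -/(vertices_of ps) ups !disj ?defB ?set21 ?set22 // !andbT.
    by apply: contraTneq eab => ->; rewrite e_irr.
  by move=> x; rewrite /= !inE -/(vertices_of ps) mps defB !inE orbA.
have [|ps [eps ups mps]] := gen (enum M) (enum_uniq _).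
  by move=> B; rewrite mem_enum.
exists ps; split=> // x; rewrite mps; apply/hasP.
have : x \in cover M by rewrite cM inE.
by case/bigcupP=> B BM xB; exists B; rewrite ?mem_enum.
Qed.

Lemma size_vertices_of (ps : seq (V * V)) : size (vertices_of ps) = (size ps).*2.
Proof. by elim: ps => //= p ps ->; rewrite doubleS. Qed.

End Graph.

(** * Plays of the game and Staller's responses *)

Section Game.
Variable V : finType.
Implicit Types (sigma : strategy V) (cs : seq bool) (p : position V).

Lemma dom_play_round o c p : dom p \subset dom (play_round o c p).
Proof. by rewrite /play_round; do !case: ifP => _ //=; rewrite subsetUr. Qed.

Lemma card_dom_play sigma cs : #|dom (play sigma cs)| <= size cs.
Proof.
elim: cs => [|c cs IH] /=; first by rewrite cards0.
by rewrite /play_round; do !case: ifP => _ //=; rewrite ?cardsU1; lia.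
Qed.

Lemma disjoint_play sigma cs x : legal sigma ->
  x \in dom (play sigma cs) -> x \notin stal (play sigma cs).
Proof.
move=> leg; elim: cs => [|c cs IH] /=; first by rewrite inE.
rewrite /play_round; case: ifP => U1 /=; last first.
  by move=> xD; rewrite !inE xD IH.
have [neq] := leg cs U1; rewrite !inE !negb_or => /andP[d1 s1] /andP[d2 s2].
case: c; rewrite /= !inE negb_or => /predU1P[->|xD].
- by rewrite eq_sym neq.
- by rewrite IH // andbT; apply: contraNneq d1 => <-.
- by rewrite neq.
- by rewrite IH // andbT; apply: contraNneq d2 => <-.
Qed.

(** A decrease by one, truncated at zero, also covers a last single vertex and an exhausted board;
    it suffices to empty the board within [#|V|] rounds. *)
Lemma card_unclaimed_play sigma c cs : legal sigma ->
  #|unclaimed (play sigma (c :: cs))| <= #|unclaimed (play sigma cs)|.-1.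
Proof.
move=> leg /=; rewrite /play_round; case: ifP => U1; last first.
  rewrite (_ : unclaimed _ = set0) ?cards0 //.
  by apply/setP => x; rewrite !inE; case: (x \in dom _); case: (x \in stal _).
have [_ o1U _] := leg cs U1.
rewrite (cardsD1 (sigma cs).1 (unclaimed (play sigma cs))) o1U /=.
apply: subset_leq_card; apply/subsetP => x.
by case: c; rewrite !inE; do !case: (_ == _); do !case: (_ \in _).
Qed.

(* Staller keeps the vertex that comes first in [L]; the vertices outside [L]
   have index [size L] and come last. *)
Definition responses (L : seq V) sigma : nat -> seq bool :=
  fix cs k := if k is k'.+1 then
    let o := sigma (cs k') in (index o.1 L <= index o.2 L) :: cs k' else [::].

Lemma size_responses L sigma k : size (responses L sigma k) = k.
Proof. by elim: k => //= k ->. Qed.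

Lemma dom_responses_mono L sigma k k' : k <= k' ->
  dom (play sigma (responses L sigma k))
    \subset dom (play sigma (responses L sigma k')).
Proof.
move=> /subnK <-; elim: (k' - k) => // j IH.
exact: subset_trans IH (dom_play_round _ _ _).
Qed.

Lemma responses_end L sigma k : legal sigma ->
  #|V| <= k -> unclaimed (play sigma (responses L sigma k)) = set0.
Proof.
move=> leg Vk; apply/eqP; rewrite -cards_eq0 -leqn0.
suff: #|unclaimed (play sigma (responses L sigma k))| <= #|V| - k.
  by move/leq_trans; apply; lia.
elim: k {Vk} => [|k IH]; first by rewrite subn0 max_card.
rewrite [responses _ _ _]/=; apply: leq_trans (card_unclaimed_play _ _ leg) _.
by lia.
Qed.

(** In each proper round Staller's new vertex does not come after Dominator's in [L], so a prefix
    that gains Dominator's vertex gains Staller's too. *)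
Lemma responses_ballot L sigma k j : uniq L -> legal sigma ->
  count (mem (dom (play sigma (responses L sigma k)))) (take j L)
    <= count (mem (stal (play sigma (responses L sigma k)))) (take j L).
Proof.
move=> uL leg; elim: k => [|k IH] //=.
set cs := responses L sigma k in IH *.
rewrite /play_round; case: ifP => U1 /=; last first.
  by apply: leq_trans IH (sub_count _ _) => x /=; rewrite inE => ->; rewrite orbT.
have [_] := leg cs U1; rewrite !inE !negb_or => /andP[d1 s1] /andP[d2 s2].
have early s d : index s L <= index d L -> (d \in take j L) <= (s \in take j L).
  move=> sd; case dj: (d \in take j L) => //.
  have dL := mem_take dj; rewrite in_take // in dj.
  by rewrite in_take ?(leq_ltn_trans sd dj) // -index_mem (leq_ltn_trans sd) ?index_mem.
case: (leqP (index (sigma cs).1 L)) => o12 /=; rewrite !count_setU1_uniq ?take_uniq // leq_add //.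
  exact: early.
exact/early/ltnW.
Qed.

End Game.

(** One list [L] serves against all strategies of Dominator and at every stage of play, which gives
    both lower bounds and the impossibility without a perfect matching. *)
Lemma domination_vs_responses (V : finType) (e : rel V) : tree e ->
  exists L : seq V, forall sigma, legal sigma -> forall k (A : {set V}),
    dominating e A -> A \subset dom (play sigma (responses L sigma k)) ->
    has_perfect_matching e /\ #|A|.*2 = #|V|.
Proof.
move=> [sg _ acyc].
have [L uL [_ PL]] := peeling_order [set: V] sg acyc.
exists L => sigma leg k A domA AD.
(* The play is continued until the board is exhausted: only then is Staller's set the complement of
   Dominator's, as [ballot] requires. Dominator's set keeps containing [A]. *)
pose K := maxn k #|V|.
have {}AD := subset_trans AD (dom_responses_mono L sigma (leq_maxl k #|V|)).
rewrite -/K in AD; set p := play sigma (responses L sigma K) in AD.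
have Dc : ~: dom p = stal p.
  apply/setP => x; rewrite inE; apply/idP/idP; last first.
    by apply: contraTN; exact: disjoint_play.
  have /setP/(_ x) := responses_end L leg (leq_maxr k #|V| : #|V| <= K).
  by rewrite -/p !inE; case: (x \in dom p); case: (x \in stal p).
have [|[w _ wS]|[[M Me Mp]]] := PL (dom p).
- by move=> j; rewrite Dc; exact: responses_ballot.
- have /orP[wA|/existsP[u /andP[uA euw]]] := forallP domA w.
    by have := wS w (in_setT _); rewrite eqxx (subsetP AD _ wA) => /(_ isT).
  have := wS u (in_setT _); rewrite (proj1 sg) euw orbT (subsetP AD _ uA).
  by move/(_ isT).
rewrite setIT cardsT => ind cD; split.
  by exists M; rewrite /perfect_matching Me.
by rewrite (dominating_indep AD domA ind).
Qed.

(** * Dominator's pairing strategy *)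

Section Pairing.
Variables (V : finType) (e : rel V) (x0 : V) (ps : seq (V * V)).
Hypotheses (sg : simple_graph e) (eps : all (fun p => e p.1 p.2) ps).
Hypotheses (ups : uniq (vertices_of ps)) (mps : forall x, x \in vertices_of ps).

(** The default [(x0, x0)] is reached only once all pairs are used up; the board is then empty and
    the offer is ignored. *)
Definition pairing : strategy V := fun cs => nth (x0, x0) ps (size cs).

Lemma mem_vertices_of (qs : seq (V * V)) q :
  q \in qs -> (q.1 \in vertices_of qs) /\ (q.2 \in vertices_of qs).
Proof.
by move=> qqs; split; apply/flattenP; exists [:: q.1; q.2];
  rewrite ?inE ?eqxx ?orbT //; apply/mapP; exists q.
Qed.

(** The invariant of the strategy. Using [take] in the size bound caps it at [size ps] even when
    play runs past the last pair. *)
Lemma play_pairing cs (p := play pairing cs) :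
  [/\ unclaimed p =i vertices_of (drop (size cs) ps),
      all (fun q => (q.1 \in dom p) || (q.2 \in dom p)) (take (size cs) ps)
    & #|dom p| <= size (take (size cs) ps)].
Proof.
rewrite {}/p; elim: cs => [|c cs [IHU IHD IHc]] /=.
  by rewrite drop0 take0; split; rewrite ?cards0 // => x; rewrite !inE mps.
set p := play pairing cs in IHU IHD IHc *.
have [szc|szc] := leqP (size ps) (size cs).
  have U0 : unclaimed p = set0.
    by apply/setP => x; rewrite IHU drop_oversize ?inE.
  rewrite !(@drop_oversize _ (size cs).+1) ?(leqW szc) //.
  rewrite !(@take_oversize _ (size cs).+1) ?(leqW szc) //.
  rewrite take_oversize // in IHD IHc.
  rewrite /play_round U0 cards0 set0U /=; split=> // x.
  by move/setP/(_ x): U0; rewrite !inE.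
rewrite (take_nth (x0, x0)) // all_rcons size_rcons.
have dropE := drop_nth (x0, x0) szc.
set o := nth _ _ _ in dropE *.
have oE : pairing cs = o by [].
have ud : uniq (vertices_of (drop (size cs) ps)).
  move: ups; rewrite -{1}(cat_take_drop (size cs) ps) /vertices_of map_cat.
  by rewrite flatten_cat cat_uniq => /and3P[].
rewrite dropE /= -/(vertices_of _) inE negb_or in ud.
case/and3P: ud => /andP[o12 o1] o2 _.
have UE x : (x \in unclaimed p)
    = [|| x == o.1, x == o.2 | x \in vertices_of (drop (size cs).+1 ps)].
  by rewrite IHU dropE /= !inE.
have U1 : 1 < #|unclaimed p|.
  by apply/card_gt1P; exists o.1, o.2; rewrite !UE !eqxx orbT.
have IHD' (D : {set V}) : dom p \subset D ->
    all (fun q => (q.1 \in D) || (q.2 \in D)) (take (size cs) ps).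
  move=> /subsetP sD; apply: sub_all IHD => q.
  by case/orP=> /sD ->; rewrite ?orbT.
rewrite /play_round U1 oE; split.
- move=> x; have := UE x; rewrite !inE.
  have [->|x1] := eqVneq x o.1.
    by rewrite (negPf o1) => _; case: c; rewrite /= !inE eqxx ?orbT.
  have [->|x2] := eqVneq x o.2.
    by rewrite (negPf o2) => _; case: c; rewrite /= !inE eqxx ?orbT.
  by case: c; rewrite /= !inE (negPf x1) (negPf x2).
- by case: c; rewrite /= setU11 ?orbT /=; apply: IHD'; exact: subsetUr.
- by case: c; rewrite /= cardsU1 -add1n leq_add ?leq_b1.
Qed.

Lemma legal_pairing : legal pairing.
Proof.
move=> cs; have [UE _ _] := play_pairing cs.
have [szc|szc] := leqP (size ps) (size cs).
  rewrite (eq_card (B := set0)) ?cards0 // => x.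
  by rewrite UE drop_oversize // inE.
move=> _; have op : pairing cs \in ps by exact: mem_nth.
have od : pairing cs \in drop (size cs) ps.
  by rewrite (drop_nth (x0, x0)) // mem_head.
have [o1 o2] := mem_vertices_of od; rewrite !UE; split=> //.
by apply: contraTneq (allP eps _ op) => ->; rewrite sg.2.
Qed.

(** A vertex that Dominator does not own is adjacent to its partner, which she then owns. *)
Lemma pairing_dominates cs :
  all (fun q => (q.1 \in dom (play pairing cs)) || (q.2 \in dom (play pairing cs))) ps ->
  dominating e (dom (play pairing cs)).
Proof.
move=> /allP Dps; apply/forallP => x.
have /flattenP[s /mapP[q qps ->]] := mps x.
have [eq Dq] := (allP eps q qps, Dps q qps).
rewrite !inE => /orP[]/eqP->; case/orP: Dq => qD; rewrite ?qD //=;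
  apply/orP; right; apply/existsP.
- by exists q.2; rewrite qD sg.1.
- by exists q.1; rewrite qD.
Qed.

End Pairing.

Theorem theorem1p7 (V : finType) (e : rel V) (n : nat)
    (card_V : #|V| = n) (tree_e : tree e) :
  (has_perfect_matching e ->
     gammaWC e = Some (n %/ 2) /\ sWC e = Some (n %/ 2)) /\
  (~ has_perfect_matching e -> ~ dominator_wins e).
Proof.
have [L lower] := domination_vs_responses tree_e.
split; last first.
  move=> noM [sigma leg win].
  have [A domA AD] := win _ (responses_end L leg (leqnn _)).
  by have [] := lower sigma leg _ A domA AD.
have [sg [/card_gt0P[x0 _] _] _] := tree_e.
move=> hM; have [ps [eps ups mps]] := perfect_matching_pairs sg.2 hM.
have sz : size ps = n %/ 2.
  have := card_uniqP ups; rewrite size_vertices_of.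
  by rewrite (eq_card (B := V)) ?card_V => [->|x]; [lia|rewrite mps].
have leg : legal (pairing x0 ps) := legal_pairing sg eps ups mps.
split; apply: least_eq.
- exists (pairing x0 ps) => // cs szcs.
  exists (dom (play (pairing x0 ps) cs)) => //.
  apply: pairing_dominates => //.
  by have [_ + _] := play_pairing x0 ups mps cs; rewrite take_oversize // szcs sz.
- move=> k [sigma lsigma win].
  have [A domA AD] := win _ (size_responses L sigma k).
  have [_ cA] := lower sigma lsigma _ A domA AD.
  (* Dominator gains at most one vertex per round, so the [n %/ 2] vertices of [A] take at least
     that many rounds. *)
  have := leq_trans (subset_leq_card AD) (card_dom_play _ _).
  by rewrite size_responses; lia.
- exists (pairing x0 ps) => // cs U0.
  have [UE Dps cD] := play_pairing x0 ups mps cs.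
  exists (dom (play (pairing x0 ps) cs)); last first.
    by split=> //; apply: leq_trans cD _; rewrite size_take -sz; case: ltnP => // /ltnW.
  apply: pairing_dominates => //.
  (* On an exhausted board every pair has been offered, since a pair still to come would have
     unclaimed ends. *)
  suff szc : size ps <= size cs by rewrite take_oversize in Dps.
  rewrite leqNgt; apply/negP => /(drop_nth (x0, x0)) dropE.
  by have := UE (nth (x0, x0) ps (size cs)).1; rewrite U0 dropE !inE eqxx.
- move=> s [sigma lsigma win].
  have [A domA [AD As]] := win _ (responses_end L lsigma (leqnn _)).
  by have [_] := lower sigma lsigma _ A domA AD; lia.
Qed.
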